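(* Let $X$ be a proper Gromov-hyperbolic space with compact boundary, with base point $o$, and let $\Gamma$ be a separated semigroup of isometries of $X$ whose limit set $\Lambda_\Gamma$ contains at least two points. Then the limit superior in the definition of the critical exponent of $\Gamma$ is a genuine limit: $$\delta_\Gamma=\lim_{n\to\infty}\frac1n\log\big(\#\{\gamma\in\Gamma : d(o,\gamma o)\le n\}\big).$$
   Context: Let $X$ be a metric space with base point $o$. The Gromov product is $(x|y)=\frac12(d(x,o)+d(y,o)-d(x,y))$. $X$ is $\delta$-hyperbolic if $(x|z)\ge\min\{(x|y),(y|z)\}-\delta$ for all $x,y,z\in X$, and Gromov-hyperbolic if it is $\delta$-hyperbolic for some $\delta\ge0$ ($X$ is not assumed geodesic). $X$ is proper if its closed balls are compact. A semigroup of isometries is a subset of $\mathrm{Isom}(X)$ closed under composition. Boundary: a sequence $(x_i)$ in $X$ is convergent if $\lim_{i,j\to\infty}(x_i|x_j)=\infty$. For $A\subseteq X$, $\partial A$ is the set of convergent sequences of $A$ modulo $(x_i)\sim(y_j)$ iff $\lim_{i,j\to\infty}(x_i|y_j)=\infty$. The Gromov product extends to $\overline X=X\cup\partial X$ by $(\xi|\eta)=\sup_{x_i\to\xi,\,y_j\to\eta}\liminf_{i,j\to\infty}(x_i|y_j)$, and $\overline X$ has the topology with neighbourhood basis given by the open balls of $X$ and the sets $\{x\in\overline X:(x|\xi)>-\log r\}$, $\xi\in\partial X$. The limit set of $\Gamma$ is $\Lambda_\Gamma=\partial(\Gamma o)$. A subset $A\subseteq\mathrm{Isom}(X)$ is separated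 if there is $\epsilon>0$ such that $d(\gamma o,\gamma' o)>\epsilon$ for all $\gamma\neq\gamma'$ in $A$. The critical exponent is $\delta_\Gamma=\limsup_{n\to\infty}\frac1n\log\#(B(o,n)\cap\Gamma o)$. *)

(* Defs.v *)
From HB Require Import structures.
From mathcomp Require Import all_boot all_order all_algebra.
From mathcomp Require Import all_classical all_reals all_analysis.

Set Implicit Arguments.
Unset Strict Implicit.
Unset Printing Implicit Defensive.

Import Order.TTheory GRing.Theory Num.Theory.
Import numFieldNormedType.Exports.

Local Open Scope classical_set_scope.
Local Open Scope ring_scope.

Section GromovHyperbolic.
Context {R : realType} {X : metricType R}.
Implicit Types (o x y z : X) (u v : nat -> X) (A : set X).

Definition gromov_product o x y : R :=
  2^-1 * (mdist x o + mdist y o - mdist x y).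

Definition delta_hyperbolic o (delta : R) : Prop :=
  forall x y z,
    Num.min (gromov_product o x y) (gromov_product o y z) - delta
      <= gromov_product o x z.

Definition gromov_hyperbolic o : Prop :=
  exists2 delta : R, 0 <= delta & delta_hyperbolic o delta.

(* The library's [closed_ball] is the closure of the open ball, which in a
   general metric space is smaller than the set used here. *)
Definition closed_mball x (r : R) : set X := [set y | mdist x y <= r].

Definition proper_metric : Prop := forall x (r : R), compact (closed_mball x r).

Definition gromov_asymptotic o u v : Prop :=
  gromov_product o (u p.1) (v p.2) @[p --> filter_prod \oo \oo] --> +oo.

Definition gromov_convergent o u : Prop := gromov_asymptotic o u u.

Definition gromov_class o u : set (nat -> X) :=
  [set v | gromov_convergent o v /\ gromov_asymptotic o u v].

(* Points of the boundary are the asymptoticity classes themselves, as sets of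
   sequences; asymptoticity is an equivalence relation on convergent sequences
   only when X is hyperbolic, so no quotient type is used. *)
Definition boundary o : Type :=
  {C : set (nat -> X) | exists2 u, gromov_convergent o u & C = gromov_class o u}.

HB.instance Definition _ o := gen_eqMixin (boundary o).
HB.instance Definition _ o := gen_choiceMixin (boundary o).

Definition boundary_of o A : set (boundary o) :=
  [set xi | exists2 u, (forall i, A (u i)) & sval xi u].

Definition bordification o : Type := (X + boundary o)%type.

HB.instance Definition _ o := gen_eqMixin (bordification o).
HB.instance Definition _ o := gen_choiceMixin (bordification o).

Definition tends_to o u (p : bordification o) : Prop :=
  match p with
  | inl x => u @ \oo --> x
  | inr xi => sval xi u
  end.

Definition ext_gromov_product o (p q : bordification o) : \bar R :=
  ereal_sup [set l | exists u v, [/\ tends_to u p, tends_to v q &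
    l = limf_einf (fun ij : nat * nat =>
                     (gromov_product o (u ij.1) (v ij.2))%:E)
                  (filter_prod \oo \oo)]].

Definition boundary_nbhd o (xi : boundary o) (r : R) : set (bordification o) :=
  [set p | ((- ln r)%:E < ext_gromov_product p (inr xi))%E].

(* A set is open when it contains a basic neighbourhood of each of its
   points. *)
Definition bordification_open o (U : set (bordification o)) : Prop :=
  (forall x, U (inl x) -> exists2 r : R, 0 < r & ball x r `<=` inl @^-1` U) /\
  (forall xi : boundary o, U (inr xi) ->
     exists2 r : R, 0 < r & boundary_nbhd xi r `<=` U).

Lemma bordification_openT o : bordification_open (@setT (bordification o)).
Proof. by split=> ? _; exists 1. Qed.

Lemma boundary_nbhdS o (xi : boundary o) (r s : R) :
  0 < r -> r <= s -> boundary_nbhd xi r `<=` boundary_nbhd xi s.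
Proof.
move=> r0 rs p; apply: le_lt_trans; rewrite lee_fin lerN2 ler_ln// posrE.
exact: lt_le_trans rs.
Qed.

Lemma bordification_openI o : setI_closed (@bordification_open o).
Proof.
move=> U V [U1 U2] [V1 V2]; split=> [x|xi] [Ux Vx].
  have [[r r0 rU] [s s0 sV]] := (U1 _ Ux, V1 _ Vx).
  exists (Num.min r s); first by rewrite lt_min r0.
  move=> y xy; split.
    by apply/rU/(le_ball _ xy); rewrite ge_min lexx.
  by apply/sV/(le_ball _ xy); rewrite ge_min lexx orbT.
have [[r r0 rU] [s s0 sV]] := (U2 _ Ux, V2 _ Vx).
have m0 : 0 < Num.min r s by rewrite lt_min r0.
exists (Num.min r s) => // y xy; split.
  by apply/rU/(boundary_nbhdS m0 _ xy); rewrite ge_min lexx.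
by apply/sV/(boundary_nbhdS m0 _ xy); rewrite ge_min lexx orbT.
Qed.

Lemma bordification_open_bigU o (I : Type) (f : I -> set (bordification o)) :
  (forall i, bordification_open (f i)) -> bordification_open (\bigcup_i f i).
Proof.
move=> fo; split=> [x|xi] [i _ fx].
  by have [r r0 rf] := (fo i).1 _ fx; exists r => // y /rf ?; exists i.
by have [r r0 rf] := (fo i).2 _ fx; exists r => // y /rf ?; exists i.
Qed.

HB.instance Definition _ o := isOpenTopological.Build (bordification o)
  (@bordification_openT o) (@bordification_openI o)
  (@bordification_open_bigU o).

Definition compact_boundary o : Prop :=
  compact [set (inr xi : bordification o) | xi in [set: boundary o]].

(* Isom(X) is the isometry group, so isometries are surjective. *)
Definition Isom : set (X -> X) :=
  [set g | (forall x y, mdist (g x) (g y) = mdist x y) /\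
           (forall y, exists x, g x = y)].

Definition isometry_semigroup (G : set (X -> X)) : Prop :=
  G `<=` Isom /\ (forall g h, G g -> G h -> G (g \o h)).

Definition separated_isometries o (A : set (X -> X)) : Prop :=
  exists2 eps : R, 0 < eps &
    forall g h, A g -> A h -> g <> h -> eps < mdist (g o) (h o).

Definition orbit_of o (G : set (X -> X)) : set X := [set g o | g in G].

Definition limit_set o (G : set (X -> X)) : set (boundary o) :=
  boundary_of (orbit_of o G).

(* [counting] is the cardinality with value +oo on infinite sets, and
   [lne 0 = -oo], so the exponent is an element of the extended reals. *)
Definition critical_exponent o (G : set (X -> X)) : \bar R :=
  limn_esup (fun n : nat =>
    (n%:R^-1)%:E * lne (counting (closed_mball o n%:R%R `&` orbit_of o G)))%E.

End GromovHyperbolic.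

Arguments proper_metric {R} X.
Arguments boundary_of {R X} o A.
Arguments Isom {R} X.

(* Main.v *)
Require Import Defs.
From HB Require Import structures.
From mathcomp Require Import all_boot all_order all_algebra.
From mathcomp Require Import all_classical all_reals all_analysis.
From mathcomp Require Import finmap ring lra zify.
Import Order.TTheory GRing.Theory Num.Theory.
Import numFieldNormedType.Exports.
Local Open Scope classical_set_scope.
Local Open Scope ring_scope.

Set Implicit Arguments.
Unset Strict Implicit.
Unset Printing Implicit Defensive.

(** Write |w| for the displacement d(w o, o), and let a(n) be the number of w in
    Gamma with |w| <= n. The theorem says that (1/n) log a(n) converges, and this
    follows from a weak form of supermultiplicativity: if a(n) exceeds a certain
    multiple of (n + 1)^3, then a(n)^k is at most a(k (n + c) + c) times the
    k-th power of a polynomial in n, for all k and with c independent of n and k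
    ([growth]). A single large n with (1/n) log a(n) close to the limit superior
    then keeps (1/m) log a(m) almost as large for all large m
    ([exponential_lower_bound]).

    Two distinct limit points give an element g of Gamma such that g o and
    g^-1 o are seen from o in different directions while |g| is as long as
    desired ([axis_element]): g is a long loxodromic element. It serves twice.

    Multiplying w by g on either side as long as this shortens w by more than 1
    leads after at most n steps to an element g^i w g^j of length at most |w|,
    which is reduced: neither multiplication by g shortens it by more than 1. For
    fixed i and j the passage from w to g^i w g^j is injective, so that up to a factor
    polynomial in n all elements may be counted as reduced ones
    ([trim_reduced], [uniform_reduced]). Geometrically, a reduced w has its end
    w o away from g^-1 o, and its backward end w^-1 o away from g o.

    Consequently, if f and w are reduced, then in the product f g g w the two
    copies of g separate the directions of f^-1 o and g g w o, there is
    only bounded cancellation, and f o lies almost between o and f g g w o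
    ([no_cancellation], [product_along]). If the same product arises from two
    factors f, f' of almost equal length, then f o and f' o are close; since
    Gamma is separated and X is proper, at most N factors f' are possible for a
    given f ([orbit_packing]). Products with k factors therefore have
    multiplicity at most N^k, which gives the supermultiplicativity. *)

(** * Counting by fibres *)

Lemma leq_card_fibers (T U : choiceType) (A : {fset T}) (B : {fset U})
    (f : T -> U) (N : nat) :
  (forall x, x \in A -> f x \in B) ->
  (forall u, u \in B -> (#|` [fset x in A | f x == u]%fset| <= N)%N) ->
  (#|` A| <= N * #|` B|)%N.
Proof.
move=> AB fibN; rewrite card_fset_sum1 (partition_big_imfset _ f A) /=.
have imB : ([fset f x | x in A] `<=` B)%fset.
  by apply/fsubsetP => _ /imfsetP[x /= xA ->]; exact: AB.
apply: (@leq_trans (\sum_(u <- [fset f x | x in A]%fset) N)%N).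
  rewrite big_seq [leqRHS]big_seq; apply: leq_sum => u uim.
  apply: leq_trans (fibN u (fsubsetP imB _ uim)).
  rewrite -big_filter sum1_size; apply: uniq_leq_size => [|x].
    by rewrite filter_uniq ?fset_uniq.
  by rewrite mem_filter !inE andbC.
by rewrite big_const_seq count_predT iter_addn_0 leq_mul2l fsubset_leq_card ?orbT.
Qed.

(** The pigeonhole principle, for a map into a finite type. *)
Lemma popular_fiber (T : choiceType) (U : finType) (u0 : U) (A : {fset T})
    (f : T -> U) :
  exists u, (#|` A| <= #|` [fset x in A | f x == u]%fset| * #|U|)%N.
Proof.
pose fib u := #|` [fset x in A | f x == u]%fset|.
exists [arg max_(u > u0) fib u]%N; case: arg_maxnP => // u _ umax.
apply: leq_trans (leq_card_fibers (B := [fset f x | x in A]%fset) _ _) _.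
- by move=> x xA; apply/imfsetP; exists x.
- by move=> v _; exact: umax.
rewrite leq_mul2l cardE uniq_leq_size ?orbT ?fset_uniq // => v _.
by rewrite mem_enum.
Qed.

(** * Packing in the orbit *)

Definition orbit_ball (R : realType) (X : metricType R) (o : X)
    (Gamma : set (X -> X)) (f : X -> X) (r : R) : set (X -> X) :=
  [set g | Gamma g /\ mdist (f o) (g o) <= r].

(** The isometry f carries the closed ball around o to the one around f o, so a
    finite cover of the former by balls of radius eps/2 serves for every f, and
    each of these balls contains at most one point x with f x in a given
    eps-separated orbit. *)
Lemma orbit_packing (R : realType) (X : metricType R) (o : X) (Gamma : set (X -> X))
    (r : R) :
  proper_metric X -> separated_isometries o Gamma ->
  exists N : nat, forall f, Isom X f ->
    finite_set (orbit_ball o Gamma f r) /\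
    (#|` fset_set (orbit_ball o Gamma f r)| <= N)%N.
Proof.
move=> prX [e e0 sep].
(* [compact_cover] applies to pointed spaces; o serves as the point. *)
pose Y : ptopologicalType :=
  HB.pack (X : Type) (Topological.class X) (isPointed.Build X o).
have := prX o r; rewrite (@compact_cover Y).
move=> /(_ X setT (fun x => (ball x (e / 2))^°)) [||D _ Dcov].
- by move=> x _; exact: open_interior.
- by move=> x _; exists x => //; apply: nbhsx_ballx; rewrite divr_gt0.
exists #|` D| => f [fiso fsurj].
set S := orbit_ball _ _ _ _.
have ScardD : (S #<= `I_#|` D|)%card.
  pose h c := xget f [set g | S g /\ exists2 x, f x = g o & ball c (e / 2) x].
  have Sh : S `<=` h @` [set` D].
    move=> g [Gg fg]; have [x fx] := fsurj (g o).
    have [|c cD /interior_subset cx] := Dcov x.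
      by rewrite /closed_mball/= -fiso fx.
    exists c => //; rewrite /h; case: xgetP => [k _ [[Gk _] [y fy cy]]|/(_ g)];
      last first.
      by case; split=> //; exists x.
    apply: contrapT => kg; have := sep _ _ Gk Gg kg.
    rewrite -fx -fy fiso ltNge => /negP; apply.
    move: cx cy; rewrite /= !ballEmdist/= => cx cy.
    by have := metric_triangle y c x; rewrite (metric_sym y c); lra.
  apply: (card_le_trans (subset_card_le Sh)).
  apply: (card_le_trans (card_image_le _ _)).
  by have := introT card_eq_fsetP (erefl #|` D|); rewrite card_eq_le => /andP[].
split; last exact: geq_card_fset_set.
by apply: card_le_finite ScardD _; exact: finite_II.
Qed.

(** * Cancellation in products of isometries *)

Section Geometry.
Context {R : realType} {X : metricType R} (o : X).
Implicit Types (x y p q : X) (g w f : X -> X).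

(** The length of g, as an element of a group acting on X with base point o. *)
Definition displ g : R := mdist (g o) o.

Lemma gromov_productC x y : gromov_product o x y = gromov_product o y x.
Proof. by rewrite /gromov_product (metric_sym x y) (addrC (mdist x o)). Qed.

Lemma gromov_productxx x : gromov_product o x x = mdist x o.
Proof. by rewrite /gromov_product mdistxx; lra. Qed.

(** The point p is the inverse image f^-1 o. Thus twice the Gromov product of
    f^-1 o and y is the excess of the distances from o to f o and from o to y over
    the distance from o to f y: the cancellation in a product f w with w o = y. *)
Lemma gromov_product_pre f p y : Isom X f -> f p = o ->
  gromov_product o p y = 2^-1 * (displ f + mdist y o - mdist (f y) o).
Proof.
move=> [fI _] fp; rewrite /gromov_product /displ.
by rewrite -(fI p o) -(fI p y) fp (metric_sym o (f o)) (metric_sym o (f y)).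
Qed.

Lemma gromov_product_image f p y : Isom X f -> f p = o ->
  gromov_product o (f o) (f y) = displ f - gromov_product o p y.
Proof.
move=> fI fp; rewrite (gromov_product_pre _ fI fp) /gromov_product fI.1.
by rewrite /displ (metric_sym o y); lra.
Qed.

(** Multiplying w by g, on either side, shortens it by at most 1. The margin 1
    makes repeated shortening stop after finitely many steps. *)
Definition reduced g w :=
  displ w - 1 <= displ (g \o w) /\ displ w - 1 <= displ (w \o g).

Context (delta : R) (hyp : delta_hyperbolic o delta) (delta0 : 0 <= delta).
Context (g : X -> X) (gI : Isom X g) (p : X) (gp : g p = o) (K : R).
Hypotheses (axis : gromov_product o (g o) p <= K)
  (long : 2 * K + 4 * delta + 1 < displ g).

(** The bound on the Gromov products that reducedness provides: about half of the
    step |g|, hence much less than the length of g \o g. *)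
Definition half_step : R := (displ g + 1) / 2.

(** The half of reducedness that concerns w o alone, weakened by delta so that it
    is inherited by products: w o is not in the direction of g^-1 o. *)
Definition ahead w := gromov_product o p (w o) <= half_step + delta.

Lemma displ_ge0 w : 0 <= displ w. Proof. exact: mdist_ge0. Qed.

Lemma pre_displ f q : Isom X f -> f q = o -> mdist q o = displ f.
Proof. by move=> [fI _] fq; rewrite -fI fq metric_sym. Qed.

Lemma displ_sqr : 2 * displ g - 2 * K <= displ (g \o g).
Proof.
move: axis; rewrite gromov_productC (gromov_product_pre _ gI gp).
by rewrite /displ /=; lra.
Qed.

Lemma Isom_comp f1 f2 : Isom X f1 -> Isom X f2 -> Isom X (f1 \o f2).
Proof.
move=> [i1 s1] [i2 s2]; split=> [x y|y] /=; first by rewrite i1 i2.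
by have [x <-] := s1 y; have [z <-] := s2 x; exists z.
Qed.

Lemma reduced_ahead w : reduced g w -> gromov_product o p (w o) <= half_step.
Proof.
by move=> [+ _]; rewrite (gromov_product_pre _ gI gp) /half_step /displ /=; lra.
Qed.

Lemma reduced_behind f q : Isom X f -> f q = o -> reduced g f ->
  gromov_product o q (g o) <= half_step.
Proof.
by move=> fI fq [_]; rewrite (gromov_product_pre _ fI fq) /half_step /displ /=; lra.
Qed.

Lemma ge_min_or (a b c : R) : Num.min a b <= c -> a <= c \/ b <= c.
Proof. by rewrite ge_min => /orP. Qed.

(** Suppose that q = f^-1 o and g g w o were in the same direction. Since g^-2 o
    continues the direction of g^-1 o and w o avoids the latter, g g w o is in
    the direction of g g o, which is also that of g o, for a length of more than
    [half_step + delta]. So q would be in the direction of g o, which [reduced]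
    excludes. *)
Lemma no_cancellation f q w : Isom X f -> f q = o -> reduced g f -> ahead w ->
  gromov_product o q (g (g (w o))) <= half_step + delta.
Proof.
move=> fI fq fred; rewrite /ahead => wa.
(* p2 is the point g^-2 o. *)
have [p2 gp2] := gI.2 p.
have ggI := Isom_comp gI gI.
have ggp2 : (g \o g) p2 = o by rewrite /= gp2.
have D0 := displ_ge0 g; have DD := displ_sqr.
have lo := long; have d0 := delta0.
have pp2 : gromov_product o p p2 = 2^-1 * displ (g \o g).
  rewrite /gromov_product (pre_displ gI gp) (pre_displ ggI ggp2).
  by rewrite -(gI.1 p p2) gp gp2 (metric_sym o p) (pre_displ gI gp); lra.
have p2w : gromov_product o p2 (w o) <= half_step + 2 * delta.
  have h := hyp p p2 (w o).
  have [] : gromov_product o p p2 <= half_step + 2 * delta \/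
            gromov_product o p2 (w o) <= half_step + 2 * delta by apply: ge_min_or; lra.
    by rewrite pp2 /half_step => ?; lra.
  by [].
have ggw : gromov_product o (g (g o)) (g (g (w o))) =
    displ (g \o g) - gromov_product o p2 (w o).
  exact: (gromov_product_image _ ggI ggp2).
have gg : gromov_product o (g o) (g (g o)) = 2^-1 * displ (g \o g).
  by rewrite (gromov_product_image _ gI gp) (gromov_product_pre _ gI gp) /displ /=; lra.
have qg := reduced_behind fI fq fred.
have h1 := hyp (g (g (w o))) (g (g o)) (g o).
have h2 := hyp q (g (g (w o))) (g o).
rewrite gromov_productC ggw (gromov_productC (g (g o))) gg in h1.
have {h1} h1 : half_step + delta < gromov_product o (g (g (w o))) (g o).
  apply: lt_le_trans h1; rewrite ltrBrDr lt_min.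
  by apply/andP; split; rewrite /half_step in p2w *; lra.
have [|//|] := @ge_min_or (gromov_product o q (g (g (w o))))
  (gromov_product o (g (g (w o))) (g o)) (half_step + delta).
  by lra.
by lra.
Qed.

(** Bounded cancellation means that f o lies almost between o and f g g w o, so
    that f o and f g g w o share their direction for nearly the length of f. *)
Lemma product_along f w : Isom X f -> reduced g f -> ahead w ->
  displ f - half_step - delta <= gromov_product o (f o) (f (g (g (w o)))).
Proof.
move=> fI fred wa; have [q fq] := fI.2 o.
by rewrite (gromov_product_image _ fI fq); have := no_cancellation fI fq fred wa; lra.
Qed.

(** The direction of a product is that of its first factor f, provided that f is
    long; so the products can be extended on the left indefinitely, and the
    constant does not deteriorate. *)
Lemma ahead_product f w : Isom X f -> reduced g f -> ahead w ->
  2 * half_step + 2 * delta < displ f -> ahead (f \o g \o g \o w).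
Proof.
move=> fI fred wa flong; rewrite /ahead /=.
have := product_along fI fred wa; have := reduced_ahead fred; have := delta0.
have := hyp p (f (g (g (w o)))) (f o); rewrite (gromov_productC (f _)) => h d0 ra h2.
have [] := @ge_min_or (gromov_product o p (f (g (g (w o)))))
  (gromov_product o (f o) (f (g (g (w o))))) (half_step + delta); by lra.
Qed.

(** Both f o and f' o share the direction of the common end point for nearly
    their whole length, hence that of each other, and the lengths agree up to
    1. *)
Lemma common_product_close f f' w w' :
  Isom X f -> Isom X f' -> reduced g f -> reduced g f' -> ahead w -> ahead w' ->
  `|displ f - displ f'| <= 1 -> f \o g \o g \o w = f' \o g \o g \o w' ->
  mdist (f o) (f' o) <= 1 + 2 * half_step + 4 * delta.
Proof.
move=> fI fI' fr fr' wa wa' ff' /(congr1 (fun u => u o)) /= E.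
have d0 := delta0; have h1 := product_along fI fr wa.
have h2 := product_along fI' fr' wa'.
have := hyp (f o) (f (g (g (w o)))) (f' o).
rewrite {2}E (gromov_productC (f' (g _))) => h3.
have : Num.min (displ f) (displ f') - half_step - delta - delta <=
    gromov_product o (f o) (f' o).
  apply: le_trans h3; rewrite lerD2r le_min.
  have : Num.min (displ f) (displ f') <= displ f by rewrite ge_min lexx.
  have : Num.min (displ f) (displ f') <= displ f' by rewrite ge_min lexx orbT.
  by move=> ? ?; apply/andP; split; lra.
have -> : mdist (f o) (f' o) =
    displ f + displ f' - 2 * gromov_product o (f o) (f' o).
  by rewrite /gromov_product /displ; lra.
have := ler_norml (displ f - displ f') 1; rewrite ff' => /esym/andP[].
by rewrite minElt; case: ifP => _; lra.
Qed.

End Geometry.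

(** * An element with an axis *)

Lemma gromov_asymptoticP (R : realType) (X : metricType R) (o : X) (u v : nat -> X) :
  gromov_asymptotic o u v <->
  forall M : R, exists N : nat, forall i j, (N <= i)%N -> (N <= j)%N ->
    M <= gromov_product o (u i) (v j).
Proof.
split=> [/cvgryPge uv M|uv].
  have [[P Q] [[n1 _ Pn] [n2 _ Qn]] PQ] := uv M.
  exists (maxn n1 n2) => i j; rewrite !geq_max => /andP[i1 i2] /andP[j1 j2].
  by apply: (PQ (i, j)); split; [exact: Pn|exact: Qn].
apply/cvgryPge => M; have [N HN] := uv M.
exists ([set i | (N <= i)%N], [set j | (N <= j)%N]); first by split; exists N.
by move=> [i j] [/= Ni Nj]; exact: HN.
Qed.

Section TwoDirections.
Context {R : realType} {X : metricType R} (o : X) (delta : R).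
Hypotheses (hyp : delta_hyperbolic o delta) (delta0 : 0 <= delta).

Lemma gromov_asymptotic_sym (u v : nat -> X) :
  gromov_asymptotic o u v -> gromov_asymptotic o v u.
Proof.
move=> /gromov_asymptoticP uv; apply/gromov_asymptoticP => M.
by have [N HN] := uv M; exists N => i j Ni Nj; rewrite gromov_productC HN.
Qed.

Lemma gromov_asymptotic_trans (u v w : nat -> X) :
  gromov_asymptotic o u v -> gromov_asymptotic o v w -> gromov_asymptotic o u w.
Proof.
move=> /gromov_asymptoticP uv /gromov_asymptoticP vw.
apply/gromov_asymptoticP => M.
have [[N1 H1] [N2 H2]] := (uv (M + delta), vw (M + delta)).
exists (maxn N1 N2) => i j; rewrite !geq_max => /andP[i1 i2] /andP[j1 j2].
apply: le_trans (hyp (u i) (v (maxn N1 N2)) (w j)).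
by rewrite lerBrDr le_min H1 ?H2 ?leq_maxl ?leq_maxr.
Qed.

Lemma boundary_eq (xi eta : boundary o) (u v : nat -> X) :
  sval xi u -> sval eta v -> gromov_asymptotic o u v -> xi = eta.
Proof.
move: xi eta => [C [c cc CE]] [D [d dd DE]] /= Cu Dv uv.
have : C = D.
  move: Cu Dv; rewrite CE DE => -[_ cu] [_ dv].
  have cd := gromov_asymptotic_trans (gromov_asymptotic_trans cu uv)
    (gromov_asymptotic_sym dv).
  apply/seteqP; split=> w [ww ?]; split=> //.
    exact: gromov_asymptotic_trans (gromov_asymptotic_sym cd) _.
  exact: gromov_asymptotic_trans cd _.
by move=> CD; exact: eq_exist.
Qed.

Lemma norm_unbounded (xi : boundary o) (u : nat -> X) (M : R) :
  sval xi u -> exists N : nat, forall i, (N <= i)%N -> M <= mdist (u i) o.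
Proof.
case: xi => C [c _ CE] /=; rewrite CE => -[/gromov_asymptoticP uu _].
by have [N HN] := uu M; exists N => i Ni; rewrite -(gromov_productxx o) HN.
Qed.

(** Representatives of two distinct boundary points are not asymptotic, so along
    arbitrarily late indices their Gromov product stays below a fixed K, while
    their distances to o tend to infinity. *)
Lemma two_directions (Gamma : set (X -> X)) :
  (exists xi eta : boundary o,
     [/\ limit_set Gamma xi, limit_set Gamma eta & xi <> eta]) ->
  exists K : R, forall M : R, exists g1 g2,
    [/\ Gamma g1, Gamma g2, gromov_product o (g1 o) (g2 o) <= K,
        M <= displ o g1 & M <= displ o g2].
Proof.
move=> [xi [eta [[u uG xiu] [v vG etav] xieta]]].
have : ~ gromov_asymptotic o u v by move=> /(boundary_eq xiu etav).
move=> /gromov_asymptoticP/existsNP[K /forallNP uvK]; exists K => M.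
have [N1 H1] := norm_unbounded M xiu.
have [N2 H2] := norm_unbounded M etav.
have /existsNP[i /existsNP[j]] := uvK (maxn N1 N2).
rewrite !not_implyE !geq_max => -[/andP[i1 i2] [/andP[j1 j2]]].
move=> /negP; rewrite -ltNge => uvij.
have [[g1 G1 g1u] [g2 G2 g2v]] := (uG i, vG j).
exists g1, g2; rewrite /displ g1u g2v; split=> //; first exact: ltW.
  exact: H1.
exact: H2.
Qed.

(** Take long g1 and g2 in different directions. If the inverse of g1 or of g2 has
    a direction different from that of the element itself, this element will do.
    Otherwise the inverse of each points in the same direction as the element, so
    that g1^-1 o and g2 o are in different directions; in g1 g2 there is then
    little cancellation, it points in the direction of g1, and its inverse in
    the direction of g2. The constant K has to be found before the lower bound
    M, because the geometry requires g to be long compared with K. *)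
Lemma axis_element (Gamma : set (X -> X)) :
  isometry_semigroup Gamma ->
  (exists xi eta : boundary o,
     [/\ limit_set Gamma xi, limit_set Gamma eta & xi <> eta]) ->
  exists K : R, forall M : R, exists g p,
    [/\ Gamma g, g p = o, gromov_product o (g o) p <= K & M < displ o g].
Proof.
move=> [GI GM] /two_directions[K0 dirs]; exists (K0 + 3 * delta) => M.
have [g1 [g2 [G1 G2 K12 M1 M2]]] := dirs (`|M| + 2 * `|K0| + 4 * delta + 1).
have d0 := delta0; have Mn := ler_norm M; have Kn := ler_norm K0.
have Mn0 := normr_ge0 M; have Kn0 := normr_ge0 K0.
have [I1 I2] := (GI _ G1, GI _ G2).
have [[q1 gq1] [q2 gq2]] := (I1.2 o, I2.2 o).
have [le1|lt1] := leP (gromov_product o (g1 o) q1) (K0 + 3 * delta).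
  by exists g1, q1; split=> //; lra.
have [le2|lt2] := leP (gromov_product o (g2 o) q2) (K0 + 3 * delta).
  by exists g2, q2; split=> //; lra.
have q1g2 : gromov_product o q1 (g2 o) <= K0 + delta.
  have h := hyp (g1 o) q1 (g2 o).
  have [] : gromov_product o (g1 o) q1 <= K0 + delta \/
            gromov_product o q1 (g2 o) <= K0 + delta by apply: ge_min_or; lra.
    by lra.
  by [].
have g1q2 : gromov_product o (g1 o) q2 <= K0 + delta.
  have h := hyp (g1 o) q2 (g2 o); rewrite (gromov_productC o q2) in h.
  have [//|] : gromov_product o (g1 o) q2 <= K0 + delta \/
            gromov_product o (g2 o) q2 <= K0 + delta by apply: ge_min_or; lra.
  by lra.
have [p gp] := I2.2 q1.
have ggo : gromov_product o (g1 o) (g1 (g2 o)) =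
    displ o g1 - gromov_product o q1 (g2 o).
  exact: gromov_product_image I1 gq1.
have g12 : displ o (g1 \o g2) =
    displ o g1 + displ o g2 - 2 * gromov_product o q1 (g2 o).
  by rewrite (gromov_product_pre _ I1 gq1) /displ /=; lra.
have q2p : gromov_product o q2 p = displ o g2 - gromov_product o q1 (g2 o).
  rewrite (gromov_product_pre _ I2 gq2) gp (pre_displ I1 gq1).
  by rewrite (pre_displ (Isom_comp I1 I2)) /= ?gp // g12; lra.
have goq2 : gromov_product o (g1 (g2 o)) q2 <= K0 + 2 * delta.
  have h := hyp (g1 o) (g1 (g2 o)) q2; rewrite ggo in h.
  have [|//] : displ o g1 - gromov_product o q1 (g2 o) <= K0 + 2 * delta \/
     gromov_product o (g1 (g2 o)) q2 <= K0 + 2 * delta by apply: ge_min_or; lra.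
  by lra.
exists (g1 \o g2), p; split; [exact: GM|by rewrite /= gp| |by lra].
have h := hyp (g1 (g2 o)) p q2; rewrite (gromov_productC o p) q2p in h.
have [//|] : gromov_product o (g1 (g2 o)) p <= K0 + 3 * delta \/
  displ o g2 - gromov_product o q1 (g2 o) <= K0 + 3 * delta by apply: ge_min_or; lra.
by lra.
Qed.

End TwoDirections.

(** * Reduction of orbit elements *)

Section Trimming.
Context {R : realType} {X : metricType R} (o : X) (Gamma : set (X -> X)).
Hypothesis semigroup : isometry_semigroup Gamma.
Variable g : X -> X.
Hypothesis Gg : Gamma g.

Definition trim (i j : nat) (w : X -> X) : X -> X := iter i g \o w \o iter j g.

Lemma trim_inj i j : injective (trim i j).
Proof.
have [giso gsurj] := semigroup.1 _ Gg.
have iterinj k : injective (iter k g).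
  elim: k => [|k IH] x y //= => gxy; apply: IH; apply: mdist_positivity.
  by rewrite -giso gxy mdistxx.
have itersurj k y : exists x, iter k g x = y.
  elim: k y => [|k IH] y; first by exists y.
  by have [z <-] := gsurj y; have [x <-] := IH z; exists x.
move=> w w' ww'; apply/funext => y; have [x <-] := itersurj j y.
exact: (iterinj i) (congr1 (fun f => f x) ww').
Qed.

(** Every multiplication by g that violates reducedness decreases the length by
    more than 1, so that at most n of them are possible. *)
Lemma trim_reduced (n : nat) (w : X -> X) : Gamma w -> displ o w <= n%:R ->
  exists i j, [/\ (i <= n)%N, (j <= n)%N, Gamma (trim i j w),
    reduced o g (trim i j w) & displ o (trim i j w) <= displ o w].
Proof.
elim: n w => [|n IH] w Gw wn.
  exists 0, 0; split=> //.
  by have := displ_ge0 o (g \o w); have := displ_ge0 o (w \o g); split; lra.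
have [rw|] := pselect (reduced o g w); first by exists 0, 0; split.
rewrite -natr1 in wn.
move=> /not_andP[/negP|/negP]; rewrite -ltNge => sw.
  have [||i [j [i0 j0 Gt rt dt]]] := IH (g \o w); [exact: semigroup.2|by lra|].
  have E : trim i.+1 j w = trim i j (g \o w).
    by apply/funext => x; rewrite /trim /= -iterSr.
  by exists i.+1, j; rewrite E; split=> //; [exact: leq_trans j0 _|lra].
have [||i [j [i0 j0 Gt rt dt]]] := IH (w \o g); [exact: semigroup.2|by lra|].
by exists i, j.+1; split=> //; [exact: leq_trans i0 _|lra].
Qed.

End Trimming.

(** * Growth of the orbit *)

Section Growth.
Context {R : realType} {X : metricType R} (o : X) (Gamma : set (X -> X)).
Hypotheses (prX : proper_metric X) (semigroup : isometry_semigroup Gamma)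
  (sep : separated_isometries o Gamma).

Definition orbit_count (r : R) : nat := #|` fset_set (orbit_ball o Gamma id r)|.

Lemma Isom_id : Isom X id.
Proof. by split=> // y; exists y. Qed.

Lemma finite_orbit_ball f r : Isom X f -> finite_set (orbit_ball o Gamma f r).
Proof.
by move=> fI; have [N HN] := orbit_packing r prX sep; have [] := HN f fI.
Qed.

Lemma orbit_ball_idE w r : orbit_ball o Gamma id r w <-> Gamma w /\ displ o w <= r.
Proof. by rewrite /orbit_ball /displ /= metric_sym. Qed.

Lemma leq_orbit_count (A : {fset X -> X}) r :
  (forall w, w \in A -> Gamma w /\ displ o w <= r) -> (#|` A| <= orbit_count r)%N.
Proof.
move=> Ar; apply: fsubset_leq_card; apply/fsubsetP => w wA.
rewrite in_fset_set; last exact: (finite_orbit_ball _ Isom_id).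
by rewrite in_setE; apply/orbit_ball_idE; exact: Ar.
Qed.

Lemma orbit_count_le r s : r <= s -> (orbit_count r <= orbit_count s)%N.
Proof.
move=> rs; apply: leq_orbit_count => w.
rewrite in_fset_set; last exact: (finite_orbit_ball _ Isom_id).
by rewrite in_setE => /orbit_ball_idE[Gw wr]; split=> //; exact: le_trans rs.
Qed.

Lemma displ_comp f w : Isom X f -> displ o (f \o w) <= displ o f + displ o w.
Proof.
move=> [fI _]; rewrite /displ /= addrC -(fI (w o)).
exact: metric_triangle.
Qed.

Context (delta : R) (hyp : delta_hyperbolic o delta) (delta0 : 0 <= delta).
Context (g : X -> X) (Gg : Gamma g) (p : X) (gp : g p = o) (K : R).
Hypotheses (axis : gromov_product o (g o) p <= K)
  (long : 2 * K + 4 * delta + 1 < displ o g).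

(** The elements of length at most n are classified by the exponents i and j of
    a reduction g^i w g^j and by the integral part of its length. There are
    (n + 1)^3 classes, and on the most popular one the reduction is injective
    because i and j are fixed. *)
Lemma uniform_reduced (n : nat) : exists A : {fset X -> X},
  [/\ (orbit_count n%:R <= #|` A| * n.+1 ^ 3)%N,
      forall w, w \in A -> [/\ Gamma w, reduced o g w & displ o w <= n%:R] &
      forall w w', w \in A -> w' \in A -> `|displ o w - displ o w'| <= 1].
Proof.
set B := fset_set (orbit_ball o Gamma id n%:R).
have inB w : (w \in B) -> Gamma w /\ displ o w <= n%:R.
  rewrite in_fset_set; last exact: (finite_orbit_ball _ Isom_id).
  by rewrite in_setE => /orbit_ball_idE.
have /choice[c cP] : forall w, exists ij : nat * nat, w \in B ->
    [/\ (ij.1 <= n)%N, (ij.2 <= n)%N, Gamma (trim g ij.1 ij.2 w),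
      reduced o g (trim g ij.1 ij.2 w) &
      displ o (trim g ij.1 ij.2 w) <= displ o w].
  move=> w; have [wB|wB] := boolP (w \in B); last by exists (0, 0).
  have [Gw wn] := inB w wB.
  by have [i [j Hij]] := trim_reduced semigroup Gg Gw wn; exists (i, j).
pose t w := trim g (c w).1 (c w).2 w.
pose f w : 'I_n.+1 * 'I_n.+1 * 'I_n.+1 :=
  (inord (c w).1, inord (c w).2, inord (Num.truncn (displ o (t w)))).
have [u Hu] := popular_fiber (ord0, ord0, ord0) B f.
have fP w : w \in B -> f w == u ->
    [/\ (c w).1 = u.1.1, (c w).2 = u.1.2 &
        u.2%:R <= displ o (t w) < u.2.+1%:R].
  move=> wB /eqP <-; have [i0 j0 _ _ tw] := cP w wB; rewrite /= !inordK ?ltnS //.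
    by split=> //; apply: truncn_itv; exact: displ_ge0.
  have [_ wn] := inB w wB.
  rewrite -(ler_nat R); apply: le_trans (le_trans tw wn).
  by rewrite truncn_le displ_ge0.
set F := [fset w in B | f w == u]%fset in Hu.
have inF w : w \in F -> w \in B /\ f w == u.
  by rewrite !inE => /andP.
exists [fset t w | w in F]%fset; split.
- have -> : #|` [fset t w | w in F]%fset| = #|` F|.
    rewrite card_in_imfset //= => w w' /inF[wB fw] /inF[wB' fw'] tt.
    have [c1 c2 _] := fP w wB fw; have [c1' c2' _] := fP w' wB' fw'.
    by move: tt; rewrite /t c1 c2 c1' c2' => /(trim_inj semigroup Gg).
  have -> : (n.+1 ^ 3 = n.+1 * n.+1 * n.+1)%N by lia.
  by move: Hu; rewrite !card_prod !card_ord.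
- move=> _ /imfsetP[w /= /inF[wB fw] ->].
  have [_ _ Gt rt tw] := cP w wB; split=> //.
  by apply: le_trans tw _; have [] := inB w wB.
move=> _ _ /imfsetP[w /= /inF[wB fw] ->] /imfsetP[w' /= /inF[wB' fw'] ->].
have [_ _ /andP[l1 l2]] := fP w wB fw; have [_ _ /andP[l1' l2']] := fP w' wB' fw'.
rewrite -natr1 in l2 l2'.
by rewrite ler_norml; apply/andP; split; lra.
Qed.

Let hs := half_step o g.

(** The product f g g w determines f up to N possibilities, by
    [common_product_close], and f together with the product determines w. *)
Lemma product_step (N : nat) (A W : {fset X -> X}) :
  (forall f, Isom X f ->
    (#|` fset_set (orbit_ball o Gamma f (1 + 2 * hs + 4 * delta))| <= N)%N) ->
  (forall w, w \in A -> Gamma w /\ reduced o g w) ->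
  (forall w w', w \in A -> w' \in A -> `|displ o w - displ o w'| <= 1) ->
  (forall w, w \in W -> Gamma w /\ ahead o delta g p w) ->
  exists2 W' : {fset X -> X}, (#|` A| * #|` W| <= N * #|` W'|)%N &
    forall v, v \in W' -> exists f w, [/\ f \in A, w \in W & v = f \o g \o g \o w].
Proof.
move=> packN AG A1 WG.
pose m (x : (X -> X) * (X -> X)) := x.1 \o g \o g \o x.2.
exists [fset m x | x in (A `*` W)%fset]%fset; last first.
  by move=> _ /imfsetP[[f w] /= /[!inE] /andP[fA wW] ->]; exists f, w.
have cM : (#|` A| * #|` W| <= #|` (A `*` W)%fset|)%N.
  rewrite -(size_allpairs pair); apply: uniq_leq_size.
    by rewrite allpairs_uniq ?fset_uniq // => -[? ?] [? ?].
  by move=> _ /allpairsP[x [xA xW ->]]; rewrite in_fsetM /= xA.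
apply: leq_trans cM _; apply: (leq_card_fibers (f := m)).
  by move=> x xAW; apply/imfsetP; exists x.
move=> _ /imfsetP[[f0 w0] /= /[!inE] /andP[/= f0A w0W] ->].
have [Gf0 rf0] := AG _ f0A; have [Gw0 aw0] := WG _ w0W.
have GI := semigroup.1.
apply: leq_trans (packN f0 (GI _ Gf0)).
set F := [fset x in _ | _]%fset.
have inF x : x \in F -> [/\ x.1 \in A, x.2 \in W & m x = m (f0, w0)].
  by rewrite !inE => /andP[/andP[? ?] /eqP].
have <- : #|` [fset x.1 | x in F]%fset| = #|` F|.
  rewrite card_in_imfset //= => -[f w] [f' w'] /inF[/= fA _ E] /inF[/= _ _ E'] ff'.
  congr pair => //; apply/funext => y.
  have := congr1 (fun h => h y) (etrans E (esym E')).
  rewrite /m /= -ff' => /(congr1 (mdist^~ (f (g (g (w' y)))))).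
  rewrite mdistxx (GI _ (AG _ fA).1).1 !(GI _ Gg).1.
  exact: mdist_positivity.
apply: fsubset_leq_card; apply/fsubsetP => _ /imfsetP[[f w] /= /inF[/= fA wW E] ->].
have [Gf rf] := AG _ fA; have [Gw aw] := WG _ wW.
rewrite in_fset_set; last exact: (finite_orbit_ball _ (GI _ Gf0)).
rewrite in_setE; split=> //.
by apply: (common_product_close hyp delta0 (GI _ Gg) gp axis long
  _ _ _ _ aw0 aw _ (esym E)); auto.
Qed.

(** The words f1 g g f2 g g ... fk g g g, with letters fi taken from the set A
    of [uniform_reduced], give the elements counted on the right. Every
    letter has to be long for [ahead_product] to apply; this is the role of the
    hypothesis on n: if one element of A were short, then all of A, whose lengths
    differ by at most 1, would be contained in the ball of radius l. *)
Lemma growth : exists N l c : nat, forall n k : nat,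
  (n.+1 ^ 3 * orbit_count l%:R < orbit_count n%:R)%N ->
  (orbit_count n%:R ^ k <= (n.+1 ^ 3 * N) ^ k * orbit_count (k * (n + c) + c)%:R)%N.
Proof.
have [N packN] := orbit_packing (1 + 2 * hs + 4 * delta) prX sep.
pose l := (Num.truncn (2 * hs + 2 * delta + 1)).+1.
pose c := (Num.truncn (2 * displ o g)).+1.
have lP : 2 * hs + 2 * delta + 1 <= l%:R.
  by apply: ltW; exact: truncnS_gt.
have cP : 2 * displ o g <= c%:R.
  by apply: ltW; exact: truncnS_gt.
have g0 := displ_ge0 o g; have d0 := delta0; have lo := long; have ax := axis.
have gI : Isom X g by exact: semigroup.1.
exists N, l, c => n k nbig.
have [A [nA AG A1]] := uniform_reduced n.
have Abig w : w \in A -> 2 * hs + 2 * delta < displ o w.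
  move=> wA; rewrite ltNge; apply/negP => wsmall.
  have : (#|` A| <= orbit_count l%:R)%N.
    apply: leq_orbit_count => w' w'A; have [Gw' _ _] := AG _ w'A; split=> //.
    by have := A1 _ _ w'A wA; rewrite ler_norml => /andP[_]; lra.
  rewrite leqNgt => /negP; apply; rewrite -(@ltn_pmul2l (n.+1 ^ 3)) ?expn_gt0 //.
  by apply: leq_trans nbig _; rewrite mulnC.
suff [W WG cW] : exists2 W : {fset X -> X},
    forall w, w \in W -> [/\ Gamma w, ahead o delta g p w &
                            displ o w <= (k * (n + c) + c)%:R] &
    (orbit_count n%:R ^ k <= (n.+1 ^ 3 * N) ^ k * #|` W|)%N.
  apply: leq_trans cW _; rewrite leq_mul2l; apply/orP; right.
  by apply: leq_orbit_count => w /WG[].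
elim: k => [|k [W WG cW]].
  exists [fset g]%fset; last by rewrite cardfs1.
  move=> w /[!inE] /eqP ->; split=> //; last by rewrite mul0n add0n; lra.
  by rewrite /ahead gromov_productC /half_step; lra.
have [|||W' cW' WG'] := @product_step N A W _ _ A1.
- by move=> f fI; have [] := packN f fI.
- by move=> w /AG[].
- by move=> w /WG[].
exists W'.
  move=> _ /WG'[f [w [fA wW ->]]].
  have [[Gf rf fn] [Gw aw wk]] := (AG _ fA, WG _ wW); split.
  - by do 3 (apply: semigroup.2 => //).
  - exact: (ahead_product hyp delta0 gI gp axis long (semigroup.1 _ Gf)
      rf aw (Abig _ fA)).
  have fI := semigroup.1 _ Gf.
  have := displ_comp (g \o g \o w) fI; have := displ_comp (g \o w) gI.
  have := displ_comp w gI.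
  rewrite mulSn !natrD; rewrite natrD in wk.
  by rewrite /displ /= in fn wk cP g0 *; lra.
rewrite !(expnS _ k).
apply: leq_trans (leq_mul nA cW) _.
rewrite -[leqRHS]mulnA.
have -> : (#|` A| * n.+1 ^ 3 * ((n.+1 ^ 3 * N) ^ k * #|` W|) =
  n.+1 ^ 3 * (n.+1 ^ 3 * N) ^ k * (#|` A| * #|` W|))%N by lia.
apply: leq_trans (leq_mul (leqnn _) cW') _.
by rewrite mulnACA.
Qed.

End Growth.

(** * Growth rates *)

Section GrowthRate.
Context {R : realType}.
Implicit Types (s t : R) (a : nat -> nat).

Lemma real_between (x y : \bar R) : (x < y)%E -> exists s, (x < s%:E < y)%E.
Proof.
case: x y => [x||] [y||] //=.
- rewrite lte_fin => xy; exists ((x + y) / 2).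
  by rewrite !lte_fin; apply/andP; split; lra.
- by move=> _; exists (x + 1); rewrite lte_fin ltry andbT; lra.
- by move=> _; exists (y - 1); rewrite lte_fin ltNyr /=; lra.
- by move=> _; exists 0; rewrite ltNyr ltry.
Qed.

(** The fourth power of 1 + s n / 4 <= exp (s n / 4) beats every cubic
    polynomial. *)
Lemma cubic_le_expR s C : 0 < s ->
  exists n0 : nat, forall n, (n0 <= n)%N -> n.+1%:R ^+ 3 * C <= expR (s * n%:R).
Proof.
move=> s0; pose e := Num.min (s / 4) 1.
have e0 : 0 < e by rewrite lt_min ltr01 andbT; lra.
exists (Num.truncn (C / e ^+ 4)).+1 => n nn0.
have n1 : C / e ^+ 4 <= n.+1%:R.
  apply: ltW; apply: lt_le_trans (truncnS_gt _) _; rewrite ler_nat.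
  exact: leqW.
rewrite (_ : s * n%:R = 4%:R * (s / 4 * n%:R)); last by field.
rewrite expRM_natl.
apply: (@le_trans _ _ ((e * n.+1%:R) ^+ 4)).
  have -> : (e * n.+1%:R) ^+ 4 = n.+1%:R ^+ 3 * (n.+1%:R * e ^+ 4) by ring.
  by rewrite ler_wpM2l ?exprn_ge0 // -ler_pdivrMr ?exprn_gt0.
have es : e <= s / 4 by rewrite ge_min lexx.
have e1 : e <= 1 by rewrite ge_min lexx orbT.
rewrite lerXn2r ?nnegrE ?expR_ge0 ?mulr_ge0 ?(ltW e0) //.
apply: le_trans (expR_ge1Dx _); rewrite -natr1 mulrDr mulr1 addrC lerD //.
by rewrite ler_wpM2r.
Qed.

Definition growth_rate a (n : nat) : \bar R :=
  ((n%:R^-1)%:E * lne ((a n)%:R)%:E)%E.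

Lemma growth_rate_ge a s n : (0 < n)%N ->
  (s%:E <= growth_rate a n)%E = (expR (s * n%:R) <= (a n)%:R).
Proof.
move=> n0; rewrite /growth_rate; have n0' : (0 : R) < n%:R by rewrite ltr0n.
have [->|an0] := eqVneq (a n) 0%N.
  rewrite le0_lneNy // gt0_muleNy ?lte_fin ?invr_gt0 //.
  by rewrite leNgt ltNyr /=; symmetry; apply/negbTE; rewrite -ltNge expR_gt0.
have an0' : (0 : R) < (a n)%:R by rewrite ltr0n lt0n.
rewrite lne_EFin // -EFinM lee_fin mulrC ler_pdivlMr //.
by rewrite -[in RHS](lnK an0') ler_expR.
Qed.

Lemma frequently_growth_rate_ge a t : (t%:E < limn_esup (growth_rate a))%E ->
  forall n0, exists2 n, (n0 <= n)%N & (t%:E <= growth_rate a n)%E.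
Proof.
move=> tL n0; apply: contrapT => no; move: tL; rewrite ltNge => /negP; apply.
apply: (@le_trans _ _
  (ereal_sup [set growth_rate a n | n in [set n | (n0 <= n)%N]])).
  by apply: ereal_inf_lbound; exists [set n | (n0 <= n)%N] => //; exists n0.
apply: ge_ereal_sup => _ [n /= n0n <-]; rewrite leNgt; apply/negP => tn.
by apply: no; exists n => //; exact: ltW.
Qed.

Lemma cvg_growth_rate a :
  (forall s, (s%:E < limn_esup (growth_rate a))%E ->
     exists n0, forall n, (n0 <= n)%N -> (s%:E <= growth_rate a n)%E) ->
  growth_rate a @ \oo --> limn_esup (growth_rate a).
Proof.
set u := growth_rate a => ev.
have L : limn_einf u = limn_esup u.
  apply/eqP; rewrite eq_le limn_einf_sup /= leNgt.
  apply/negP => /real_between[s /andP[s1 s2]].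
  have [n0 Hn0] := ev _ s2; move: s1; rewrite ltNge => /negP; apply.
  rewrite limn_einf_lim; apply: lime_ge; first exact: is_cvg_einfs.
  exists n0 => // n /= n0n; apply: le_ereal_inf_tmp => _ [k /= nk <-].
  by apply: Hn0; exact: leq_trans nk.
apply: (@squeeze_cvge _ _ _ _ (einfs u) _ (esups u)).
- near=> n; apply/andP; split.
    by apply: ereal_inf_lbound; exists n => /=.
  by apply: ereal_sup_ubound; exists n => /=.
- by rewrite -L limn_einf_lim; exact: is_cvg_einfs.
- by rewrite limn_esup_lim; exact: is_cvg_esups.
Unshelve. all: by end_near. Qed.

Section AlmostSupermultiplicative.
Variables (a : nat -> nat) (N l c : nat).
Hypotheses (a_le : {homo a : m n / (m <= n)%N})
  (a_mul : forall n k, (n.+1 ^ 3 * a l < a n)%N ->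
     (a n ^ k <= (n.+1 ^ 3 * N) ^ k * a (k * (n + c) + c))%N).

(** Choose r strictly between s and t and one large n with
    exp (t n) <= a(n), such that the factor (n + 1)^3 N is negligible against
    exp ((t - r) n). Then [a_mul] gives a(k d + c) >= exp (r k d) for d = n + c and
    all k. Every m is within c + d of some k d + c, and the resulting loss
    is compensated by r > s once m is large. *)
Lemma exponential_lower_bound s t : 0 <= s -> s < t ->
  (forall n0, exists2 n, (n0 <= n)%N & expR (t * n%:R) <= (a n)%:R) ->
  exists n0, forall m, (n0 <= m)%N -> expR (s * m%:R) <= (a m)%:R.
Proof.
move=> s0 st freq; pose r := (s + t) / 2.
have rs : s < r by rewrite /r; lra.
have rt : 0 < t - r by rewrite /r; lra.
pose C : R := (a l)%:R + 1 + N%:R * expR (r * c%:R).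
have [n0 Hn0] := cubic_le_expR C rt.
have [n n0n tn] := freq (maxn n0 1).
move: n0n; rewrite geq_max => /andP[n0n n1].
have Cn := Hn0 n n0n.
have nn : (0 : R) < n.+1%:R ^+ 3 by rewrite exprn_gt0 ?ltr0Sn.
have NE : 0 <= N%:R * expR (r * c%:R) by rewrite mulr_ge0 ?expR_ge0.
have nbig : (n.+1 ^ 3 * a l < a n)%N.
  rewrite -(ltr_nat R) natrM natrX; apply: lt_le_trans tn.
  apply: (@lt_le_trans _ _ (expR ((t - r) * n%:R))); last first.
    by rewrite ler_expR ler_wpM2r //; lra.
  apply: lt_le_trans Cn; rewrite ltr_pM2l // /C; lra.
pose Q : R := (n.+1 ^ 3 * N)%:R.
(* For N = 0 the case k = 1 of the hypothesis would force a(n) = 0. *)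
have Q0 : 0 < Q.
  rewrite ltr0n lt0n; apply/eqP => Q0; have := a_mul 1 nbig.
  by rewrite Q0 expn1 exp0n // mul0n leqn0 => /eqP an0; rewrite an0 in nbig.
pose d := (n + c)%N.
have step : expR (r * d%:R) * Q <= (a n)%:R.
  apply: le_trans tn.
  have -> : t * n%:R = r * n%:R + (t - r) * n%:R by ring.
  rewrite /d natrD mulrDr !expRD -mulrA ler_pM2l ?expR_gt0 //.
  apply: le_trans Cn.
  have -> : expR (r * c%:R) * Q = n.+1%:R ^+ 3 * (N%:R * expR (r * c%:R)).
    by rewrite /Q natrM natrX; ring.
  by rewrite ler_pM2l // /C; have := ler0n R (a l); lra.
have powers k : expR (r * (k * d)%:R) <= (a (k * d + c))%:R.
  have Qk : 0 < Q ^+ k by rewrite exprn_gt0.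
  rewrite -(ler_pM2l Qk).
  have -> : Q ^+ k * expR (r * (k * d)%:R) = (expR (r * d%:R) * Q) ^+ k.
    by rewrite exprMn -expRM_natl natrM mulrCA mulrC.
  apply: (@le_trans _ _ ((a n)%:R ^+ k)).
    by rewrite lerXn2r ?nnegrE ?mulr_ge0 ?expR_ge0 // ltW.
  by rewrite /Q -!natrX -natrM ler_nat; exact: a_mul.
exists (maxn c (Num.truncn (r * (c + d)%:R / (r - s))).+1) => m.
rewrite geq_max => /andP[cm mbig].
have d0 : (0 < d)%N by rewrite addn_gt0 n1.
pose k := ((m - c) %/ d)%N.
have km : (k * d + c <= m)%N by have := leq_trunc_div (m - c) d; rewrite -/k; lia.
have mk : (m <= k * d + (c + d))%N.
  have := ltn_ceil (m - c) d0; rewrite -/k mulSn; lia.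
apply: (@le_trans _ _ (a (k * d + c))%:R); last by rewrite ler_nat; exact: a_le.
apply: le_trans (powers k); rewrite ler_expR.
have : r * (c + d)%:R <= (r - s) * m%:R.
  rewrite [leRHS]mulrC -ler_pdivrMr; last by lra.
  by apply: ltW; apply: lt_le_trans (truncnS_gt _) _; rewrite ler_nat.
have : r * m%:R <= r * (k * d + (c + d))%:R by rewrite ler_wpM2l ?ler_nat //; lra.
rewrite natrD; lra.
Qed.

Lemma cvg_growth_rate_supermultiplicative : (exists m, (0 < a m)%N) ->
  growth_rate a @ \oo --> limn_esup (growth_rate a).
Proof.
move=> [m0 am0]; apply: cvg_growth_rate => s /real_between[t /andP[st tL]].
rewrite lte_fin in st.
have [t0|t0] := leP t 0.
  exists (maxn m0 1) => n; rewrite geq_max => /andP[mn n1].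
  rewrite growth_rate_ge //; apply: (@le_trans _ _ 1).
    by rewrite -[leRHS]expR0 ler_expR mulr_le0_ge0 //; lra.
  by rewrite ler1n; apply: leq_trans am0 (a_le mn).
have [||n0|n0 Hn0] := @exponential_lower_bound (Num.max s 0) t.
- by rewrite le_max lexx orbT.
- by rewrite gt_max st.
- have [n] := frequently_growth_rate_ge tL (maxn n0 1).
  rewrite geq_max => /andP[n0n n1].
  by rewrite growth_rate_ge // => tn; exists n.
exists (maxn n0 1) => n; rewrite geq_max => /andP[n0n n1].
rewrite growth_rate_ge //; apply: le_trans (Hn0 n n0n).
by rewrite ler_expR ler_wpM2r // le_max lexx.
Qed.

End AlmostSupermultiplicative.
End GrowthRate.

(** * Convergence of the critical exponent *)

Lemma counting_orbit_ball (R : realType) (X : metricType R) (o : X)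
    (Gamma : set (X -> X)) (prX : proper_metric X)
    (sep : separated_isometries o Gamma) (r : R) :
  @counting _ R (orbit_ball o Gamma id r) = ((orbit_count o Gamma r)%:R)%:E.
Proof.
by rewrite /counting asboolT //; apply: finite_orbit_ball => //; exact: Isom_id.
Qed.

(** In a separated set an element is determined by its orbit point, so counting
    orbit points and counting isometries is the same. *)
Lemma counting_orbit_points (R : realType) (X : metricType R) (o : X)
    (Gamma : set (X -> X)) (prX : proper_metric X)
    (sep : separated_isometries o Gamma) (r : R) :
  @counting _ R (closed_mball o r `&` orbit_of o Gamma)
    = ((orbit_count o Gamma r)%:R)%:E.
Proof.
have fin : finite_set (orbit_ball o Gamma id r).
  by apply: finite_orbit_ball => //; exact: Isom_id.
have -> : closed_mball o r `&` orbit_of o Gamma =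
    (fun g => g o) @` orbit_ball o Gamma id r.
  apply/seteqP; split=> [x [xr [g Gg gx]]|_ [g [Gg gr] <-]]; last first.
    by split=> //; exists g.
  by exists g => //; split=> //; rewrite /= gx.
rewrite /counting asboolT; last exact: finite_image.
rewrite fset_set_image // card_in_imfset //= => g h.
rewrite !in_fset_set // !in_setE => -[Gg _] [Gh _] gho.
apply: contrapT => gh; have [e e0 esep] := sep.
by have := esep _ _ Gg Gh gh; rewrite gho mdistxx; lra.
Qed.

Theorem mainTheorem4 (R : realType) (X : metricType R) (o : X)
    (Gamma : set (X -> X))
    (properX : proper_metric X)
    (hypX : gromov_hyperbolic o)
    (compact_bd : compact_boundary o)
    (semigroup_Gamma : isometry_semigroup Gamma)
    (separated_Gamma : separated_isometries o Gamma)
    (limit_set2 : exists xi eta : boundary o,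
       [/\ limit_set Gamma xi, limit_set Gamma eta & xi <> eta]) :
  ((n%:R^-1)%:E * lne (counting [set g | Gamma g /\ (mdist o (g o) <= n%:R)%R]))%E
    @[n --> \oo] --> critical_exponent o Gamma.
Proof.
pose a n := orbit_count o Gamma n%:R.
have -> : (fun n : nat => ((n%:R : R)^-1)%:E *
    lne (counting [set g | Gamma g /\ (mdist o (g o) <= n%:R)%R]))%E =
    growth_rate a.
  apply/funext => n.
  by rewrite /growth_rate -(counting_orbit_ball properX separated_Gamma).
have -> : critical_exponent o Gamma = limn_esup (growth_rate a).
  congr limn_esup; apply/funext => n.
  by rewrite /growth_rate -(counting_orbit_points properX separated_Gamma).
have [delta delta0 hyp] := hypX.
have [K axisK] := axis_element hyp delta0 semigroup_Gamma limit_set2.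
have [g [p [Gg gp axis long]]] := axisK (2 * K + 4 * delta + 1).
have [N [l [c grow]]] := growth properX semigroup_Gamma separated_Gamma hyp
  delta0 Gg gp axis long.
apply: (cvg_growth_rate_supermultiplicative (N := N) (l := l) (c := c)).
- by move=> m n mn; apply: orbit_count_le => //; rewrite ler_nat.
- exact: grow.
exists (Num.truncn (displ o g)).+1.
rewrite -(cardfs1 g); apply: leq_orbit_count => // w /[!inE] /eqP ->.
by split=> //; apply: ltW; exact: truncnS_gt.
Qed.
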